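(* Let $\alpha_0,\dots,\alpha_4$ be complex parameters with $2\alpha_0+2\alpha_1+2\alpha_2+\alpha_3+\alpha_4=1$, and consider the system $$\frac{dx}{dt}=\frac{2x^2y-tx^2-2\alpha_0x+1}{t}+\frac{2x^2w}{t},\qquad \frac{dy}{dt}=\frac{-2xy^2+2txy+2\alpha_0y+\alpha_1t}{t}-\frac{2w(2xy+\alpha_1)}{t},$$ $$\frac{dz}{dt}=\frac{2z^2w-tz^2-(1-\alpha_3-\alpha_4)z+1}{t}+\frac{2x(xy+\alpha_1)}{t},\qquad \frac{dw}{dt}=\frac{-2zw^2+2tzw+(1-\alpha_3-\alpha_4)w+\alpha_3t}{t}.$$ This system admits extended affine Weyl group symmetry of type $B_4^{(1)}$ as the group of its Bäcklund transformations, with generators given explicitly as follows. Writing $( * )=(x,y,z,w,t;\alpha_0,\alpha_1,\alpha_2,\alpha_3,\alpha_4)$, set $$s_0:( * )\mapsto\left(-x,-y+\tfrac{2\alpha_0}{x}-\tfrac1{x^2},-z,-w,-t;-\alpha_0,\alpha_1+2\alpha_0,\alpha_2,\alpha_3,\alpha_4\right),$$ $$s_1:( * )\mapsto\left(x+\tfrac{\alpha_1}{y},y,z,w,t;\alpha_0+\alpha_1,-\alpha_1,\alpha_2+\alpha_1,\alpha_3,\alpha_4\right),$$ $$s_2:( * )\mapsto\left(x,y-\tfrac{\alpha_2}{x-z},z,w+\tfrac{\alpha_2}{x-z},t;\alpha_0,\alpha_1+\alpha_2,-\alpha_2,\alpha_3+\alpha_2,\alpha_4+\alpha_2\right),$$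 $$s_3:( * )\mapsto\left(x,y,z+\tfrac{\alpha_3}{w},w,t;\alpha_0,\alpha_1,\alpha_2+\alpha_3,-\alpha_3,\alpha_4\right),$$ $$s_4:( * )\mapsto\left(x,y,z+\tfrac{\alpha_4}{w-t},w,t;\alpha_0,\alpha_1,\alpha_2+\alpha_4,\alpha_3,-\alpha_4\right),$$ $$\varphi:( * )\mapsto(x,y,z,w-t,-t;\alpha_0,\alpha_1,\alpha_2,\alpha_4,\alpha_3).$$ That is: (a) each of $s_0,\dots,s_4,\varphi$ is a Bäcklund transformation of the system; (b) they satisfy the defining relations of the extended affine Weyl group of type $B_4^{(1)}$.
   Context: The system is the Hamiltonian system $dx/dt=\partial H/\partial y$, $dy/dt=-\partial H/\partial x$, $dz/dt=\partial H/\partial w$, $dw/dt=-\partial H/\partial z$ with $$tH=x^2y(y-t)-x\{2\alpha_0y+\alpha_1t\}+y+z^2w(w-t)-z\{(1-\alpha_3-\alpha_4)w+\alpha_3t\}+w+2xw(xy+\alpha_1).$$ Each transformation is regarded as an automorphism of the field of rational functions in $x,y,z,w,t$ and the parameters (subject to the linear relation on the parameters), given by the images of the generators. A transformation $\sigma$ is a Bäcklund transformation if, whenever $(x(t),y(t),z(t),w(t))$ is a solution of the system with parameters $\alpha_i$ (for which the expressions are defined), the functions $\sigma(x),\sigma(y),\sigma(z),\sigma(w)$, viewed as functions of the new independent variable $\sigma(t)$, solve the same system with parameters $\sigma(\alpha_i)$. The Dynkin diagram of type $B_4^{(1)}$ is labelled here with nodes $0,\dots,4$: a double edge between $0$ and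 $1$ (arrow pointing from $1$ to $0$), simple edges $1$–$2$, $2$–$3$, $2$–$4$, and no other edges. The relations of the extended affine Weyl group are $s_i^2=1$; $(s_is_j)^2=1$ for distinct non-adjacent $i,j$; $(s_is_j)^3=1$ for $i,j$ joined by a simple edge; $(s_0s_1)^4=1$; and, for the diagram automorphism $\varphi$ interchanging nodes $3$ and $4$: $\varphi^2=1$, $\varphi s_3=s_4\varphi$, $\varphi s_i=s_i\varphi$ for $i=0,1,2$. *)

(* Defs.v *)
From HB Require Import structures.
From mathcomp Require Import all_boot all_order all_algebra.
From mathcomp Require Export complex.
From mathcomp Require mpoly.

Set Implicit Arguments.
Unset Strict Implicit.
Unset Printing Implicit Defensive.

Import GRing.Theory Num.Theory.
Local Open Scope ring_scope.

(* The definitions are over an arbitrary numFieldType C, which then carries   *)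
(* the topology and the (C-linear) derivative of normedtype/derive; the       *)
(* theorem takes C := R[i].                                                   *)

(* The field of rational functions in x,y,z,w,t,alpha_0,...,alpha_4 subject   *)
(* to the linear relation: the relation is solved for alpha_4, so the field   *)
(* is C(x,y,z,w,t,alpha_0,alpha_1,alpha_2,alpha_3). Variables 0..8 are these  *)
(* nine generators in this order, and alpha_4 is the element ra4 below.       *)
(* The module confines the notations of mpoly, which clash with those of      *)
(* mathcomp-analysis.                                                         *)
Module Export RationalFunctions.
Import mpoly.
Definition ratpoly (C : numFieldType) : idomainType := {mpoly C[9]}.
Definition ratfun (C : numFieldType) : fieldType := {fraction ratpoly C}.

Definition rcst (C : numFieldType) (c : C) : ratfun C := tofrac (c%:MP : ratpoly C).
Definition rvar (C : numFieldType) (i : 'I_9) : ratfun C := tofrac ('X_i : ratpoly C).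
Definition peval (C : numFieldType) (p : 'I_9 -> C) (a : ratpoly C) : C := a.@[p].
End RationalFunctions.

From mathcomp Require Import classical_sets topology normedtype derive.
Import numFieldNormedType.Exports.
Local Open Scope classical_set_scope.

Section Generators.
Variable C : numFieldType.
Definition rx : ratfun C := rvar C (@Ordinal 9 0 isT).
Definition ry : ratfun C := rvar C (@Ordinal 9 1 isT).
Definition rz : ratfun C := rvar C (@Ordinal 9 2 isT).
Definition rw : ratfun C := rvar C (@Ordinal 9 3 isT).
Definition rt : ratfun C := rvar C (@Ordinal 9 4 isT).
Definition ra0 : ratfun C := rvar C (@Ordinal 9 5 isT).
Definition ra1 : ratfun C := rvar C (@Ordinal 9 6 isT).
Definition ra2 : ratfun C := rvar C (@Ordinal 9 7 isT).
Definition ra3 : ratfun C := rvar C (@Ordinal 9 8 isT).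
Definition ra4 : ratfun C := 1 - 2 * ra0 - 2 * ra1 - 2 * ra2 - ra3.

Definition gens : seq (ratfun C) :=
  [:: rx; ry; rz; rw; rt; ra0; ra1; ra2; ra3; ra4].
End Generators.

(* sigma is the automorphism over C with the prescribed images of the ten     *)
(* generators.                                                                *)
Definition automorphism_with_images (C : numFieldType)
    (images : seq (ratfun C)) (sigma : {rmorphism ratfun C -> ratfun C}) : Prop :=
  [/\ bijective sigma,
      forall c : C, sigma (rcst c) = rcst c
    & [seq sigma g | g <- gens C] = images].

Section Images.
Variable C : numFieldType.
Local Notation x := (rx C).
Local Notation y := (ry C).
Local Notation z := (rz C).
Local Notation w := (rw C).
Local Notation t := (rt C).
Local Notation a0 := (ra0 C).
Local Notation a1 := (ra1 C).
Local Notation a2 := (ra2 C).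
Local Notation a3 := (ra3 C).
Local Notation a4 := (ra4 C).

Definition s0_images : seq (ratfun C) :=
  [:: - x; - y + 2 * a0 / x - 1 / x ^+ 2; - z; - w; - t;
      - a0; a1 + 2 * a0; a2; a3; a4].
Definition s1_images : seq (ratfun C) :=
  [:: x + a1 / y; y; z; w; t;
      a0 + a1; - a1; a2 + a1; a3; a4].
Definition s2_images : seq (ratfun C) :=
  [:: x; y - a2 / (x - z); z; w + a2 / (x - z); t;
      a0; a1 + a2; - a2; a3 + a2; a4 + a2].
Definition s3_images : seq (ratfun C) :=
  [:: x; y; z + a3 / w; w; t;
      a0; a1; a2 + a3; - a3; a4].
Definition s4_images : seq (ratfun C) :=
  [:: x; y; z + a4 / (w - t); w; t;
      a0; a1; a2 + a4; a3; - a4].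
Definition phi_images : seq (ratfun C) :=
  [:: x; y; z; w - t; - t;
      a0; a1; a2; a4; a3].

Definition s_images (i : 'I_5) : seq (ratfun C) :=
  nth [::] [:: s0_images; s1_images; s2_images; s3_images; s4_images] i.
End Images.

Definition phase_point (C : numFieldType) (x y z w t a0 a1 a2 a3 : C) : 'I_9 -> C :=
  fun i => nth 0 [:: x; y; z; w; t; a0; a1; a2; a3] i.

(* f is defined at p, with value v: some fraction representing f has a        *)
(* denominator that does not vanish at p (v does not depend on the fraction). *)
Definition has_value (C : numFieldType) (f : ratfun C) (p : 'I_9 -> C) (v : C)
    : Prop :=
  exists a b : ratpoly C,
    [/\ peval p b != 0, f = tofrac a / tofrac b
      & v = peval p a / peval p b].

Definition defined_at (C : numFieldType) (f : ratfun C) (p : 'I_9 -> C) : Prop :=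
  exists v : C, has_value f p v.

Definition is_solution (C : numFieldType) (a0 a1 a2 a3 a4 : C)
    (D : set C) (x y z w : C -> C) : Prop :=
  [/\ open D,
      forall t, D t -> t != 0
    & forall t, D t ->
      [/\ is_derive t 1 x
            ((2 * x t ^+ 2 * y t - t * x t ^+ 2 - 2 * a0 * x t + 1) / t
             + 2 * x t ^+ 2 * w t / t),
          is_derive t 1 y
            ((- 2 * x t * y t ^+ 2 + 2 * t * x t * y t + 2 * a0 * y t + a1 * t) / t
             - 2 * w t * (2 * x t * y t + a1) / t),
          is_derive t 1 z
            ((2 * z t ^+ 2 * w t - t * z t ^+ 2 - (1 - a3 - a4) * z t + 1) / t
             + 2 * x t * (x t * y t + a1) / t)
        & is_derive t 1 w
            ((- 2 * z t * w t ^+ 2 + 2 * t * z t * w t + (1 - a3 - a4) * w t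
              + a3 * t) / t)]].

(* X, Y, Z, W are sigma(x), sigma(y), sigma(z), sigma(w) as functions of the  *)
(* new independent variable T = sigma(t); b0, ..., b4 are the new parameters. *)
Definition Backlund (C : numFieldType) (sigma : ratfun C -> ratfun C) : Prop :=
  forall (a0 a1 a2 a3 a4 : C) (D : set C) (x y z w : C -> C),
    2 * a0 + 2 * a1 + 2 * a2 + a3 + a4 = 1 ->
    is_solution a0 a1 a2 a3 a4 D x y z w ->
    let p t := phase_point (x t) (y t) (z t) (w t) t a0 a1 a2 a3 in
    (forall t, D t -> forall g, g \in gens C -> defined_at (sigma g) (p t)) ->
    exists (b0 b1 b2 b3 b4 : C) (T X Y Z W : C -> C),
      (forall t, D t ->
        [/\ has_value (sigma (rt C)) (p t) (T t),
            [/\ has_value (sigma (rx C)) (p t) (X (T t)),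
                has_value (sigma (ry C)) (p t) (Y (T t)),
                has_value (sigma (rz C)) (p t) (Z (T t))
              & has_value (sigma (rw C)) (p t) (W (T t))]
          & [/\ has_value (sigma (ra0 C)) (p t) b0,
                has_value (sigma (ra1 C)) (p t) b1,
                has_value (sigma (ra2 C)) (p t) b2,
                has_value (sigma (ra3 C)) (p t) b3
              & has_value (sigma (ra4 C)) (p t) b4]]) /\
      is_solution b0 b1 b2 b3 b4 (T @` D) X Y Z W.

Definition simple_edge (i j : 'I_5) : bool :=
  (nat_of_ord i, nat_of_ord j)
    \in [:: (1, 2); (2, 1); (2, 3); (3, 2); (2, 4); (4, 2)]%N.
Definition double_edge (i j : 'I_5) : bool :=
  (nat_of_ord i, nat_of_ord j) \in [:: (0, 1); (1, 0)]%N.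

Definition extended_B4_relations (C : numFieldType)
    (s : 'I_5 -> {rmorphism ratfun C -> ratfun C})
    (phi : {rmorphism ratfun C -> ratfun C}) : Prop :=
  [/\ [/\ forall i, s i \o s i =1 id,
          forall i j, i != j -> ~~ simple_edge i j -> ~~ double_edge i j ->
            iter 2 (s i \o s j) =1 id,
          forall i j, simple_edge i j -> iter 3 (s i \o s j) =1 id
        & forall i j, double_edge i j -> iter 4 (s i \o s j) =1 id],
      phi \o phi =1 id,
      phi \o s (@Ordinal 5 3 isT) =1 s (@Ordinal 5 4 isT) \o phi
    & forall i : 'I_5, (i < 3)%N -> phi \o s i =1 s i \o phi].

(* Main.v *)
(* An automorphism is determined by the images of the generators, so the relations
   and the inverse of each generator are identities between rational functions.
   Existence: each list of images u is involutive as a substitution, and this makes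
   evaluation of polynomials at u injective, hence extendable to fractions.
   Backlund property: definedness of the images along the solution forces the
   denominators not to vanish, and the differential equations for the new functions
   are then rational identities after differentiation; for s0 and phi, where the new
   time is -t, the functions are moreover reflected. *)

Require Import Defs.
From HB Require Import structures.
From mathcomp Require Import all_boot all_order all_algebra.
From mathcomp Require Import generic_quotient ring reals.
From mathcomp Require mpoly.

Set Implicit Arguments.
Unset Strict Implicit.
Unset Printing Implicit Defensive.

Import GRing.Theory Num.Theory.
Local Open Scope ring_scope.

(** * Evaluation of polynomials and induction on them *)

Module Export PolynomialEvaluation.
Import mpoly.
Definition pvar (C : numFieldType) (i : 'I_9) : ratpoly C := ('X_i : {mpoly C[9]}).
Definition pcst (C : numFieldType) (c : C) : ratpoly C := c%:MP.
HB.instance Definition _ (C : numFieldType) :=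
  GRing.RMorphism.copy (@pcst C) (@mpolyC 9 C).

Section Eval.
Variables (C : numFieldType) (K : comNzRingType) (f : {rmorphism C -> K}).
Variable (u : 'I_9 -> K).
(** The coefficient morphism [f] is left general to cover three targets: substitution into
    [ratfun C], evaluation at a point of [C], and restriction to a line with values in
    [{poly C}]. *)
Definition mev (a : ratpoly C) : K := mmap f u a.
HB.instance Definition _ := GRing.RMorphism.copy mev (mmap f u).
Lemma mev_cst c : mev (pcst c) = f c.
Proof. exact: mmapC. Qed.
Lemma mev_var i : mev (pvar C i) = u i.
Proof. by rewrite /mev /pvar mmapX mmap1U. Qed.
End Eval.

HB.instance Definition _ (C : numFieldType) (p : 'I_9 -> C) :=
  GRing.RMorphism.copy (@peval C p) (mev idfun p).
Lemma peval_cst (C : numFieldType) (p : 'I_9 -> C) c : peval p (pcst c) = c.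
Proof. exact: mev_cst. Qed.
Lemma peval_var (C : numFieldType) (p : 'I_9 -> C) i : peval p (pvar C i) = p i.
Proof. exact: mev_var. Qed.

(** Gives access to polynomials through [pcst] and [pvar] alone: a monomial is unfolded into a
    product of powers of variables. *)
Lemma ratpoly_ind (C : numFieldType) (P : ratpoly C -> Prop) :
  (forall c, P (pcst c)) -> (forall i, P (pvar C i)) ->
  (forall a b, P a -> P b -> P (a + b)) ->
  (forall a b, P a -> P b -> P (a * b)) -> forall a, P a.
Proof.
move=> Pc PX PD PM; apply: mpolyind => [|c m p _ _ IH].
  by rewrite -mpolyC0; apply: Pc.
apply: PD => //; rewrite -mul_mpolyC; apply: (PM); first exact: Pc.
rewrite mpolyXE_id; elim/big_rec: _ => [|i x _ Px]; first exact: (Pc 1).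
apply: (PM) => //; elim: (m i) => [|k Pk]; first exact: (Pc 1).
by rewrite exprS; apply: (PM); first exact: PX.
Qed.
End PolynomialEvaluation.

(* Loaded only here because its notations clash with those of mpoly. *)
From mathcomp Require Import classical_sets topology normedtype derive.
Import numFieldNormedType.Exports.
Local Open Scope quotient_scope.
Local Open Scope classical_set_scope.

(** * Fractions and the extension of morphisms to them *)

HB.instance Definition _ (C : numFieldType) :=
  GRing.RMorphism.copy (@rcst C) (@tofrac (ratpoly C) \o @pcst C).

(** The representative of the quotient class supplies numerator and denominator; the equality is
    then cross multiplication. *)
Lemma fractionP (R : idomainType) (f : {fraction R}) :
  exists a b : R, b != 0 /\ f = tofrac a / tofrac b.
Proof.
elim/quotW: f => r; exists (frac r).1, (frac r).2.
have d0 := denom_ratioP r; split=> //.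
apply: (canRL (mulfK _)); first by rewrite tofrac_eq0.
rewrite mulrC; unlock tofrac; rewrite -[LHS]FracField.pi_mul.
apply/eqmodP; rewrite /= FracField.equivfE /FracField.mulf.
by rewrite !numden_Ratio ?oner_neq0 ?mul1r ?mulr1 // mulrC.
Qed.

Section RationalFunctionField.
Variable C : numFieldType.
Implicit Types (f g : ratfun C) (a b : ratpoly C).

Lemma tofrac_cst (c : C) : tofrac (pcst c) = rcst c. Proof. by []. Qed.
Lemma tofrac_var i : tofrac (pvar C i) = rvar C i. Proof. by []. Qed.

Lemma ratfun_ext (s1 s2 : {rmorphism ratfun C -> ratfun C}) :
  (forall c, s1 (rcst c) = s2 (rcst c)) ->
  (forall i, s1 (rvar C i) = s2 (rvar C i)) -> s1 =1 s2.
Proof.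
move=> eqc eqv; have eqp a : s1 (tofrac a) = s2 (tofrac a).
  elim/ratpoly_ind: a => [c|i|a b IHa IHb|a b IHa IHb].
  - exact: eqc.
  - exact: eqv.
  - by rewrite !rmorphD /= IHa IHb.
  - by rewrite !rmorphM /= IHa IHb.
by move=> f; have [a [b [_ ->]]] := fractionP f; rewrite !fmorph_div /= !eqp.
Qed.

(** Injectivity keeps images of denominators nonzero, so [h a / h b] depends only on the fraction,
    by cross multiplication. *)
Lemma extend_to_ratfun (K : fieldType) (h : {rmorphism ratpoly C -> K}) :
  (forall a, h a = 0 -> a = 0) ->
  exists s : {rmorphism ratfun C -> K}, forall a, s (tofrac a) = h a.
Proof.
move=> h_inj.
have h0 b : b != 0 -> h b != 0 by apply: contra_neq; exact: h_inj.
have uniqv a b a' b' : b != 0 -> b' != 0 -> tofrac a / tofrac b = tofrac a' / tofrac b' ->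
    h a / h b = h a' / h b'.
  move=> b0 b0' /eqP; rewrite eqr_div ?tofrac_eq0 // -!tofracM tofrac_eq => /eqP e.
  by apply/eqP; rewrite eqr_div ?h0 // -!rmorphM /= e.
(* The default 0 is never taken: by [fractionP] the set is nonempty for every [f]. *)
pose s f := xget 0 [set v | exists a b, [/\ b != 0, f = tofrac a / tofrac b & v = h a / h b]].
have sE a b : b != 0 -> s (tofrac a / tofrac b) = h a / h b.
  move=> b0; rewrite /s; case: xgetP => [v _ [a' [b' [b0' e ->]]]|].
    by apply/esym/uniqv.
  by move=> /(_ (h a / h b)) []; exists a, b.
have sp a : s (tofrac a) = h a.
  by have := sE a 1 (oner_neq0 _); rewrite !rmorph1 !divr1.
have sD : zmod_morphism s.
  move=> f g; have [a [b [b0 ->]]] := fractionP f; have [c [d [d0 ->]]] := fractionP g.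
  rewrite -mulNr addf_div ?tofrac_eq0 // -!(rmorphN, rmorphM, rmorphD) /=.
  rewrite !sE ?mulf_neq0 // -mulNr addf_div ?h0 //.
  by rewrite !(rmorphD, rmorphM, rmorphN).
have sM : monoid_morphism s.
  split=> [|f g]; first by have := sp 1; rewrite !rmorph1.
  have [a [b [b0 ->]]] := fractionP f; have [c [d [d0 ->]]] := fractionP g.
  by rewrite mulf_div -!rmorphM /= !sE ?mulf_neq0 // mulf_div !rmorphM.
pose sZ := GRing.isZmodMorphism.Build _ _ s sD.
pose sR := GRing.isMonoidMorphism.Build _ _ s sM.
pose S : {rmorphism ratfun C -> K} := HB.pack s sZ sR.
by exists S.
Qed.

Section FractionValue.
Variables (L : fieldType) (h : {rmorphism ratpoly C -> L}).

(* The partial extension of h to fractions whose denominator h does not kill. *)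
Definition frac_value (f : ratfun C) (v : L) :=
  exists a b, [/\ h b != 0, f = tofrac a / tofrac b & v = h a / h b].

Lemma frac_denom_neq0 b : h b != 0 -> tofrac b != 0 :> ratfun C.
Proof. by rewrite tofrac_eq0; apply: contra_neq => ->; rewrite rmorph0. Qed.

Lemma frac_value_poly a : frac_value (tofrac a) (h a).
Proof. by exists a, 1; rewrite !rmorph1 !divr1 oner_neq0. Qed.

(** Detects that a rational function is nonzero from one specialization: the numerator has a nonzero
    image. *)
Lemma frac_value_neq0 f v : frac_value f v -> v != 0 -> f != 0.
Proof.
move=> [a [b [b0 -> ->]]]; rewrite mulf_eq0 negb_or => /andP[a0 _].
apply: mulf_neq0; first exact: frac_denom_neq0 a0.
by rewrite invr_eq0; exact: frac_denom_neq0 b0.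
Qed.

Lemma frac_valueD f g u v :
  frac_value f u -> frac_value g v -> frac_value (f + g) (u + v).
Proof.
move=> [a [b [b0 -> ->]]] [c [d [d0 -> ->]]]; exists (a * d + c * b), (b * d).
rewrite !(rmorphD, rmorphM) /= mulf_neq0 // !addf_div ?frac_denom_neq0 //.
Qed.

Lemma frac_valueM f g u v :
  frac_value f u -> frac_value g v -> frac_value (f * g) (u * v).
Proof.
move=> [a [b [b0 -> ->]]] [c [d [d0 -> ->]]]; exists (a * c), (b * d).
by rewrite !rmorphM /= mulf_neq0 // !mulf_div.
Qed.

Lemma frac_valueN f u : frac_value f u -> frac_value (- f) (- u).
Proof.
by move=> [a [b [b0 -> ->]]]; exists (- a), b; rewrite !rmorphN /= !mulNr.
Qed.

Lemma frac_valueV f u : u != 0 -> frac_value f u -> frac_value f^-1 u^-1.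
Proof.
move=> + [a [b [b0 -> e]]]; rewrite e mulf_eq0 invr_eq0 (negbTE b0) orbF => a0.
by exists b, a; rewrite !invf_div.
Qed.

Lemma frac_value1 : frac_value 1 1.
Proof. by have := frac_value_poly 1; rewrite !rmorph1. Qed.

Lemma frac_valueX f u n : frac_value f u -> frac_value (f ^+ n) (u ^+ n).
Proof.
move=> fu; elim: n => [|n IHn]; first by rewrite !expr0; apply: frac_value1.
by rewrite !exprS; apply: frac_valueM.
Qed.

Lemma frac_value_nat n : frac_value n%:R n%:R.
Proof. by have := frac_value_poly n%:R; rewrite !rmorph_nat. Qed.

End FractionValue.

End RationalFunctionField.

(** * Automorphisms from involutive substitutions *)

Section Existence.
Variable C : numFieldType.

Lemma frac_value_var (L : fieldType) (f : {rmorphism C -> L}) (u : 'I_9 -> L) i :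
  frac_value (mev f u) (rvar C i) (u i).
Proof. by have := frac_value_poly (mev f u) (pvar C i); rewrite /= mev_var. Qed.

(* If substituting u twice gives back the variables, evaluation at u is injective:
   each fraction [mev u p], read as an element of the domain of the partial
   extension of [mev u], is sent back to p. *)
Lemma involutive_mev_inj (u : 'I_9 -> ratfun C) :
  (forall i, frac_value (mev (@rcst C) u) (u i) (rvar C i)) ->
  forall a, mev (@rcst C) u a = 0 -> a = 0.
Proof.
move=> inv a; pose ev : {rmorphism ratpoly C -> ratfun C} := mev (@rcst C) u.
change (ev a = 0 -> a = 0).
have P : frac_value ev (ev a) (tofrac a).
  elim/ratpoly_ind: a => [c|i|a b IHa IHb|a b IHa IHb].
  - rewrite /ev /= mev_cst.
    by have := frac_value_poly ev (pcst c); rewrite /ev /= mev_cst.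
  - by rewrite /ev /= mev_var; apply: inv.
  - by rewrite (rmorphD ev) rmorphD; apply: frac_valueD.
  - by rewrite (rmorphM ev) rmorphM; apply: frac_valueM.
(* If [ev a] is 0, the fraction [c / d] representing it has [c = 0], and then [tofrac a], which is
   [ev c / ev d], is 0 too. *)
move=> a0; move: P; rewrite a0 => -[c [d [d0 /esym/eqP]]].
rewrite mulf_eq0 invr_eq0 (negbTE (frac_denom_neq0 d0)) orbF tofrac_eq0 => /eqP ->.
by rewrite rmorph0 mul0r => /eqP; rewrite tofrac_eq0 => /eqP.
Qed.

Lemma involutive_automorphism (u : seq (ratfun C)) :
  size u = 10 ->
  u`_9 = 1 - 2 * u`_5 - 2 * u`_6 - 2 * u`_7 - u`_8 ->
  (forall i : 'I_9, frac_value (mev (@rcst C) (fun i : 'I_9 => u`_i)) u`_i (rvar C i)) ->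
  exists s : {rmorphism ratfun C -> ratfun C}, automorphism_with_images u s.
Proof.
move=> su u9 inv; pose ev : {rmorphism _ -> _} := mev (@rcst C) (fun i : 'I_9 => u`_i).
have [s sE] := @extend_to_ratfun C (ratfun C) ev (involutive_mev_inj inv).
have sc c : s (rcst c) = rcst c by rewrite -tofrac_cst sE /ev /= mev_cst.
have sv i : s (rvar C i) = u`_i by rewrite -tofrac_var sE /ev /= mev_var.
have ss : involutive s.
  apply: (@ratfun_ext C (s \o s) idfun) => [c|i] /=; first by rewrite !sc.
  rewrite sv; have [a [b [b0 -> ->]]] := inv i.
  by rewrite fmorph_div !sE.
exists s; split=> //; first by exists s.
apply: (@eq_from_nth _ 0); first by rewrite size_map su.
move=> [|[|[|[|[|[|[|[|[|[|//]]]]]]]]]] _; rewrite /= ?sv //.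
by rewrite u9 /ra4 !rmorphB !rmorphM !rmorph_nat rmorph1 /= !sv.
Qed.
End Existence.

Lemma frac_value_eq (C : numFieldType) (L : fieldType) (h : {rmorphism ratpoly C -> L})
  f u v : frac_value h f u -> u = v -> frac_value h f v.
Proof. by move=> fu <-. Qed.

Lemma forall_ord9 (P : 'I_9 -> Prop) :
  P (@Ordinal 9 0 isT) -> P (@Ordinal 9 1 isT) -> P (@Ordinal 9 2 isT) ->
  P (@Ordinal 9 3 isT) -> P (@Ordinal 9 4 isT) -> P (@Ordinal 9 5 isT) ->
  P (@Ordinal 9 6 isT) -> P (@Ordinal 9 7 isT) -> P (@Ordinal 9 8 isT) ->
  forall i, P i.
Proof.
move=> ? ? ? ? ? ? ? ? ? [[|[|[|[|[|[|[|[|[|//]]]]]]]]] i9];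
  by rewrite (bool_irrelevance i9 isT).
Qed.

Lemma frac_value_coord (C : numFieldType) (p : 'I_9 -> C) i :
  frac_value (peval p) (rvar C i) (p i).
Proof. by have := frac_value_poly (peval p) (pvar C i); rewrite /= peval_var. Qed.

Lemma has_value_eq (C : numFieldType) (f : ratfun C) (p : 'I_9 -> C) u v :
  frac_value (peval p) f u -> u = v -> has_value f p v.
Proof. by move=> fu <-. Qed.

Ltac frac_value_tac := repeat lazymatch goal with
  | |- frac_value _ (_ + _) _ => apply: frac_valueD
  | |- frac_value _ (- _) _ => apply: frac_valueN
  | |- frac_value _ (_ * _) _ => apply: frac_valueM
  | |- frac_value _ (_ ^+ _) _ => apply: frac_valueX
  | |- frac_value _ (_ ^-1) _ => apply: frac_valueV
  | |- frac_value _ 1 _ => apply: frac_value1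
  | |- frac_value _ _%:R _ => apply: frac_value_nat
  | |- frac_value (peval _) _ _ => apply: frac_value_coord
  | |- frac_value _ _ _ => apply: frac_value_var
  end.

(* [V f n] reads: f is defined at a fixed integer point, with value n.  It serves to
   show that the denominators below are nonzero, by evaluating them at that point. *)
Record specialization (K : fieldType) (V : K -> int -> Prop) : Prop := Specialization {
  spec_nat : forall k, V k%:R (Posz k);
  spec_one : V 1 1;
  spec_add : forall f g m n, V f m -> V g n -> V (f + g) (m + n);
  spec_opp : forall f n, V f n -> V (- f) (- n);
  spec_mul : forall f g m n, V f m -> V g n -> V (f * g) (m * n);
  spec_exp : forall f n k, V f n -> V (f ^+ k) (n ^+ k);
  spec_neq0 : forall f n, V f n -> n != 0 -> f != 0 }.

(** * The relations as rational identities on the generators *)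

Section Relations.
Variables (K : fieldType) (V : K -> int -> Prop) (spec : specialization V).
Variables x y z w t a0 a1 a2 a3 a4 : K.
(** A point where no denominator met in the relations vanishes. The value of [a4] is forced by the
    linear relation: 1 - 2 - 6 - 4 - 4 = -15. *)
Hypotheses (Vx : V x 2) (Vy : V y 3) (Vz : V z 7) (Vw : V w (- 2%:Z)) (Vt : V t 5)
  (Va0 : V a0 1) (Va1 : V a1 3) (Va2 : V a2 2) (Va3 : V a3 4) (Va4 : V a4 (- 15%:Z)).

Local Notation gens := [:: x; y; z; w; t; a0; a1; a2; a3; a4].
Local Notation im0 := [:: - x; - y + 2 * a0 / x - 1 / x ^+ 2; - z; - w; - t;
  - a0; a1 + 2 * a0; a2; a3; a4].
Local Notation im1 := [:: x + a1 / y; y; z; w; t; a0 + a1; - a1; a2 + a1; a3; a4].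
Local Notation im2 := [:: x; y - a2 / (x - z); z; w + a2 / (x - z); t;
  a0; a1 + a2; - a2; a3 + a2; a4 + a2].
Local Notation im3 := [:: x; y; z + a3 / w; w; t; a0; a1; a2 + a3; - a3; a4].
Local Notation im4 := [:: x; y; z + a4 / (w - t); w; t; a0; a1; a2 + a4; a3; - a4].
Local Notation imp := [:: x; y; z; w - t; - t; a0; a1; a2; a4; a3].

(** The integer value is an existential variable built up along the syntax of the denominator; that
    it is nonzero is then decided by computation. *)
Ltac neq0 := apply: (spec_neq0 spec);
  [repeat lazymatch goal with
   | |- V (_ + _) _ => apply: (spec_add spec)
   | |- V (- _) _ => apply: (spec_opp spec)
   | |- V (_ * _) _ => apply: (spec_mul spec)
   | |- V (_ ^+ _) _ => apply: (spec_exp spec)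
   | |- V 1 _ => apply: (spec_one spec)
   | |- V _%:R _ => apply: (spec_nat spec)
   | |- _ => eassumption
   end | by []].

Ltac on_generators f g :=
  let ef := fresh in let eg := fresh in let fx := fresh in let fy := fresh in let fz := fresh in
  let fw := fresh in let ft := fresh in let f0 := fresh in let f1 := fresh in let f2 := fresh in
  let f3 := fresh in let f4 := fresh in let gx := fresh in let gy := fresh in let gz := fresh in
  let gw := fresh in let gt := fresh in let g0 := fresh in let g1 := fresh in let g2 := fresh in
  let g3 := fresh in let g4 := fresh in
  move=> ef eg; case: ef => fx fy fz fw ft f0 f1 f2 f3 f4;
  case: eg => gx gy gz gw gt g0 g1 g2 g3 g4;
  rewrite /=; congr [:: _; _; _; _; _; _; _; _; _; _];
  rewrite !(fx, fy, fz, fw, ft, f0, f1, f2, f3, f4, gx, gy, gz, gw, gt, g0, g1, g2, g3, g4,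
    rmorphD, rmorphN, rmorphM, rmorphXn, fmorphV, rmorph_nat, rmorph1);
  try first [by [] | ring | field; repeat (apply/andP; split); neq0].

Section TwoMorphisms.
Variables f g : {rmorphism K -> K}.

(** This and the following relations are in braid form, with half of the word on each side, which
    keeps the expressions smaller; involutivity later turns them into relations on powers. *)
Lemma s0s1_images : map f gens = im0 -> map g gens = im1 ->
  [seq f (g (f (g v))) | v <- gens] = [seq g (f (g (f v))) | v <- gens].
Proof. on_generators f g. Qed.

Lemma s0s2_images : map f gens = im0 -> map g gens = im2 ->
  [seq f (g v) | v <- gens] = [seq g (f v) | v <- gens].
Proof. on_generators f g. Qed.

Lemma s0s3_images : map f gens = im0 -> map g gens = im3 ->
  [seq f (g v) | v <- gens] = [seq g (f v) | v <- gens].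
Proof. on_generators f g. Qed.

Lemma s0s4_images : map f gens = im0 -> map g gens = im4 ->
  [seq f (g v) | v <- gens] = [seq g (f v) | v <- gens].
Proof. on_generators f g. Qed.

Lemma s1s2_images : map f gens = im1 -> map g gens = im2 ->
  [seq f (g (f v)) | v <- gens] = [seq g (f (g v)) | v <- gens].
Proof. on_generators f g. Qed.

Lemma s1s3_images : map f gens = im1 -> map g gens = im3 ->
  [seq f (g v) | v <- gens] = [seq g (f v) | v <- gens].
Proof. on_generators f g. Qed.

Lemma s1s4_images : map f gens = im1 -> map g gens = im4 ->
  [seq f (g v) | v <- gens] = [seq g (f v) | v <- gens].
Proof. on_generators f g. Qed.

Lemma s2s3_images : map f gens = im2 -> map g gens = im3 ->
  [seq f (g (f v)) | v <- gens] = [seq g (f (g v)) | v <- gens].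
Proof. on_generators f g. Qed.

Lemma s2s4_images : map f gens = im2 -> map g gens = im4 ->
  [seq f (g (f v)) | v <- gens] = [seq g (f (g v)) | v <- gens].
Proof. on_generators f g. Qed.

Lemma s3s4_images : map f gens = im3 -> map g gens = im4 ->
  [seq f (g v) | v <- gens] = [seq g (f v) | v <- gens].
Proof. on_generators f g. Qed.

Lemma phis0_images : map f gens = imp -> map g gens = im0 ->
  [seq f (g v) | v <- gens] = [seq g (f v) | v <- gens].
Proof. on_generators f g. Qed.

Lemma phis1_images : map f gens = imp -> map g gens = im1 ->
  [seq f (g v) | v <- gens] = [seq g (f v) | v <- gens].
Proof. on_generators f g. Qed.

Lemma phis2_images : map f gens = imp -> map g gens = im2 ->
  [seq f (g v) | v <- gens] = [seq g (f v) | v <- gens].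
Proof. on_generators f g. Qed.

Lemma s0_involutive : map f gens = im0 -> [seq f (f v) | v <- gens] = gens.
(* The hypothesis is duplicated because the tactic takes the image lists of two morphisms. *)
Proof. move=> e; move: e (e); on_generators f f. Qed.
Lemma s1_involutive : map f gens = im1 -> [seq f (f v) | v <- gens] = gens.
Proof. move=> e; move: e (e); on_generators f f. Qed.
Lemma s2_involutive : map f gens = im2 -> [seq f (f v) | v <- gens] = gens.
Proof. move=> e; move: e (e); on_generators f f. Qed.
Lemma s3_involutive : map f gens = im3 -> [seq f (f v) | v <- gens] = gens.
Proof. move=> e; move: e (e); on_generators f f. Qed.
Lemma s4_involutive : map f gens = im4 -> [seq f (f v) | v <- gens] = gens.
Proof. move=> e; move: e (e); on_generators f f. Qed.
Lemma phi_involutive : map f gens = imp -> [seq f (f v) | v <- gens] = gens.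
Proof. move=> e; move: e (e); on_generators f f. Qed.

End TwoMorphisms.

Lemma phi_s3_s4_images (f g h : {rmorphism K -> K}) :
  map f gens = imp -> map g gens = im3 -> map h gens = im4 ->
  [seq f (g v) | v <- gens] = [seq h (f v) | v <- gens].
Proof.
move=> ef eg; case=> hx hy hz hw ht h0 h1 h2 h3 h4; move: ef eg.
on_generators f g; rewrite ?(hx, hy, hz, hw, ht, h0, h1, h2, h3, h4, rmorphD, rmorphN) //.
Qed.
End Relations.

Lemma forall_ord5 (P : 'I_5 -> Prop) :
  P (@Ordinal 5 0 isT) -> P (@Ordinal 5 1 isT) -> P (@Ordinal 5 2 isT) ->
  P (@Ordinal 5 3 isT) -> P (@Ordinal 5 4 isT) -> forall i, P i.
Proof.
by move=> ? ? ? ? ? [[|[|[|[|[|//]]]]] i5]; rewrite (bool_irrelevance i5 isT).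
Qed.

(** * Specialization at an integer point, and existence of the six automorphisms *)

Section RatfunSpecialization.
Variable C : numFieldType.

Definition int_point (i : 'I_9) : int := [:: 2; 3; 7; - 2%:Z; 5; 1; 3; 2; 4]`_i.

Definition int_value (f : ratfun C) (n : int) :=
  frac_value (peval (fun i => (int_point i)%:~R)) f n%:~R.

Lemma int_value_spec : specialization int_value.
Proof.
rewrite /int_value; split=> [k||f g m n|f n|f g m n|f n k|f n fn].
- exact: frac_value_nat.
- exact: frac_value1.
- by rewrite rmorphD; apply: frac_valueD.
- by rewrite rmorphN; apply: frac_valueN.
- by rewrite rmorphM; apply: frac_valueM.
- by rewrite rmorphXn; apply: frac_valueX.
(* Characteristic 0: a nonzero integer stays nonzero in [C]. *)
- by rewrite -(intr_eq0 C); apply: frac_value_neq0 fn.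
Qed.

Lemma int_value_var i : int_value (rvar C i) (int_point i).
Proof. exact: frac_value_var. Qed.

Lemma int_value_a4 : int_value (ra4 C) (- 15%:Z).
Proof.
have [vn v1 vD vN vM _ _] := int_value_spec.
have vX := int_value_var.
have := vD _ _ _ _ (vD _ _ _ _ (vD _ _ _ _ (vD _ _ _ _ v1
  (vN _ _ (vM _ _ _ _ (vn 2%N) (vX (@Ordinal 9 5 isT)))))
  (vN _ _ (vM _ _ _ _ (vn 2%N) (vX (@Ordinal 9 6 isT)))))
  (vN _ _ (vM _ _ _ _ (vn 2%N) (vX (@Ordinal 9 7 isT)))))
  (vN _ _ (vX (@Ordinal 9 8 isT))).
by [].
Qed.

Lemma rx_neq0 : rx C != 0.
Proof. exact: (spec_neq0 int_value_spec (int_value_var _)). Qed.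
Lemma ry_neq0 : ry C != 0.
Proof. exact: (spec_neq0 int_value_spec (int_value_var _)). Qed.
Lemma rw_neq0 : rw C != 0.
Proof. exact: (spec_neq0 int_value_spec (int_value_var _)). Qed.
Lemma rx_neq_rz : rx C - rz C != 0.
Proof.
exact: (spec_neq0 int_value_spec (spec_add int_value_spec (int_value_var _)
  (spec_opp int_value_spec (int_value_var _)))).
Qed.
Lemma rw_neq_rt : rw C - rt C != 0.
Proof.
exact: (spec_neq0 int_value_spec (spec_add int_value_spec (int_value_var _)
  (spec_opp int_value_spec (int_value_var _)))).
Qed.

(** Isolated because [- x] is inverted alongside [x], which calls for [field]; the other involution
    identities are closed by [ring]. *)
Lemma s0_twice_y (K : fieldType) (x y a0 : K) : x != 0 ->
  - (- y + 2 * a0 / x - 1 / x ^+ 2) + 2 * - a0 / - x - 1 / (- x) ^+ 2 = y.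
Proof. by move=> x0; field; rewrite oppr_eq0 x0. Qed.

Ltac solve_involution :=
  rewrite /= ?/ra4; frac_value_tac; rewrite /=; repeat lazymatch goal with
  | |- is_true (_ ^+ _ != 0) => rewrite expf_neq0 //
  | |- is_true (- _ != 0) => rewrite oppr_eq0
  | |- is_true (rx _ != 0) => exact: rx_neq0
  | |- is_true (ry _ != 0) => exact: ry_neq0
  | |- is_true (rw _ != 0) => exact: rw_neq0
  | |- is_true (rx _ - rz _ != 0) => exact: rx_neq_rz
  | |- is_true (rw _ - rt _ != 0) => exact: rw_neq_rt
  | |- _ = _ => rewrite ?/ra4; first [ring | exact: s0_twice_y rx_neq0]
  end.

Lemma s_automorphism (i : 'I_5) :
  exists s : {rmorphism ratfun C -> ratfun C}, automorphism_with_images (s_images C i) s.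
Proof.
elim/forall_ord5: i; rewrite /s_images /=;
  (apply: involutive_automorphism => //=; first by rewrite /ra4; ring);
  apply: forall_ord9; apply: frac_value_eq.
all: solve_involution.
Qed.

Lemma phi_automorphism :
  exists s : {rmorphism ratfun C -> ratfun C}, automorphism_with_images (phi_images C) s.
Proof.
apply: involutive_automorphism => //=; first by rewrite /ra4; ring.
apply: forall_ord9; apply: frac_value_eq.
all: solve_involution.
Qed.
End RatfunSpecialization.

(** * From identities on generators to relations between automorphisms *)

Section GroupWords.
Variables (T : Type) (f g : T -> T).
Hypotheses (ff : f \o f =1 id) (gg : g \o g =1 id).

Let f2 v : f (f v) = v. Proof. exact: ff. Qed.
Let g2 v : g (g v) = v. Proof. exact: gg. Qed.

Lemma iter2_comm : (forall v, f (g v) = g (f v)) -> iter 2 (f \o g) =1 id.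
Proof. by move=> fg v; rewrite /= fg !(f2, g2). Qed.

Lemma iter3_braid : (forall v, f (g (f v)) = g (f (g v))) -> iter 3 (f \o g) =1 id.
Proof. by move=> fg v; rewrite /= fg !(f2, g2). Qed.

Lemma iter4_braid :
  (forall v, f (g (f (g v))) = g (f (g (f v)))) -> iter 4 (f \o g) =1 id.
Proof. by move=> fg v; rewrite /= fg !(f2, g2). Qed.
End GroupWords.

Section RelationsOnRatfun.
Variable C : numFieldType.
Implicit Types f g : {rmorphism ratfun C -> ratfun C}.

Lemma gens_ext f g : (forall c, f (rcst c) = g (rcst c)) ->
  [seq f v | v <- gens C] = [seq g v | v <- gens C] -> f =1 g.
Proof.
by move=> fgc [*]; apply: ratfun_ext => //; apply: forall_ord9.
Qed.

Ltac known := first [eassumption | match goal with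
  V : forall i, int_value (rvar _ i) _ |- _ => exact: V end].

Lemma images_relations (s : 'I_5 -> {rmorphism ratfun C -> ratfun C})
    (phi : {rmorphism ratfun C -> ratfun C}) :
  (forall i, automorphism_with_images (s_images C i) (s i)) ->
  automorphism_with_images (phi_images C) phi -> extended_B4_relations s phi.
Proof.
move=> es [_ cp ep].
have cs i c : s i (rcst c) = rcst c by have [_ ->] := es i.
have V := @int_value_var C; have V4 := int_value_a4 C; have S := int_value_spec C.
pose s0 := s (@Ordinal 5 0 isT).
pose s1 := s (@Ordinal 5 1 isT).
pose s2 := s (@Ordinal 5 2 isT).
pose s3 := s (@Ordinal 5 3 isT).
pose s4 := s (@Ordinal 5 4 isT).
have e0 : map s0 (gens C) = s0_images C by have [] := es (@Ordinal 5 0 isT).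
have e1 : map s1 (gens C) = s1_images C by have [] := es (@Ordinal 5 1 isT).
have e2 : map s2 (gens C) = s2_images C by have [] := es (@Ordinal 5 2 isT).
have e3 : map s3 (gens C) = s3_images C by have [] := es (@Ordinal 5 3 isT).
have e4 : map s4 (gens C) = s4_images C by have [] := es (@Ordinal 5 4 isT).
have ss i : s i \o s i =1 id.
  apply: (@gens_ext (s i \o s i) idfun) => [c|]; first by rewrite /= !cs.
  rewrite [RHS]map_id; elim/forall_ord5: i;
    by [apply: s0_involutive; known | apply: s1_involutive; known
       | apply: s2_involutive; known | apply: s3_involutive; known
       | apply: s4_involutive; known].
have pp : phi \o phi =1 id.
  apply: (@gens_ext (phi \o phi) idfun) => [c|]; first by rewrite /= !cp.
  by rewrite [RHS]map_id; apply: phi_involutive; known.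
have c02 v : s0 (s2 v) = s2 (s0 v).
  apply: (@gens_ext (s0 \o s2) (s2 \o s0)) => [c|]; first by rewrite /= ?(cs, cp).
  by apply: s0s2_images; known.
have c03 v : s0 (s3 v) = s3 (s0 v).
  apply: (@gens_ext (s0 \o s3) (s3 \o s0)) => [c|]; first by rewrite /= ?(cs, cp).
  by apply: s0s3_images; known.
have c04 v : s0 (s4 v) = s4 (s0 v).
  apply: (@gens_ext (s0 \o s4) (s4 \o s0)) => [c|]; first by rewrite /= ?(cs, cp).
  by apply: s0s4_images; known.
have c13 v : s1 (s3 v) = s3 (s1 v).
  apply: (@gens_ext (s1 \o s3) (s3 \o s1)) => [c|]; first by rewrite /= ?(cs, cp).
  by apply: s1s3_images; known.
have c14 v : s1 (s4 v) = s4 (s1 v).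
  apply: (@gens_ext (s1 \o s4) (s4 \o s1)) => [c|]; first by rewrite /= ?(cs, cp).
  by apply: s1s4_images; known.
have c34 v : s3 (s4 v) = s4 (s3 v).
  apply: (@gens_ext (s3 \o s4) (s4 \o s3)) => [c|]; first by rewrite /= ?(cs, cp).
  by apply: s3s4_images; known.
have b12 v : s1 (s2 (s1 v)) = s2 (s1 (s2 v)).
  apply: (@gens_ext (s1 \o s2 \o s1) (s2 \o s1 \o s2)) => [c|]; first by rewrite /= ?(cs, cp).
  by apply: s1s2_images; known.
have b23 v : s2 (s3 (s2 v)) = s3 (s2 (s3 v)).
  apply: (@gens_ext (s2 \o s3 \o s2) (s3 \o s2 \o s3)) => [c|]; first by rewrite /= ?(cs, cp).
  by apply: s2s3_images; known.
have b24 v : s2 (s4 (s2 v)) = s4 (s2 (s4 v)).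
  apply: (@gens_ext (s2 \o s4 \o s2) (s4 \o s2 \o s4)) => [c|]; first by rewrite /= ?(cs, cp).
  by apply: s2s4_images; known.
have b01 v : s0 (s1 (s0 (s1 v))) = s1 (s0 (s1 (s0 v))).
  apply: (@gens_ext (s0 \o s1 \o s0 \o s1) (s1 \o s0 \o s1 \o s0)) => [c|]; first by rewrite /= ?(cs, cp).
  by apply: s0s1_images; known.
have p0 v : phi (s0 v) = s0 (phi v).
  apply: (@gens_ext (phi \o s0) (s0 \o phi)) => [c|]; first by rewrite /= ?(cs, cp).
  by apply: phis0_images; known.
have p1 v : phi (s1 v) = s1 (phi v).
  apply: (@gens_ext (phi \o s1) (s1 \o phi)) => [c|]; first by rewrite /= ?(cs, cp).
  by apply: phis1_images; known.
have p2 v : phi (s2 v) = s2 (phi v).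
  apply: (@gens_ext (phi \o s2) (s2 \o phi)) => [c|]; first by rewrite /= ?(cs, cp).
  by apply: phis2_images; known.
have p34 v : phi (s3 v) = s4 (phi v).
  apply: (@gens_ext (phi \o s3) (s4 \o phi)) => [c|]; first by rewrite /= ?(cs, cp).
  by apply: phi_s3_s4_images; known.
split=> //; first split=> //.
(* All pairs of nodes are enumerated. Each unordered pair was settled once above; the opposite order
   is the symmetric equality. *)
- by elim/forall_ord5=> [] ; elim/forall_ord5=> // _ _ _; apply: iter2_comm.
- by elim/forall_ord5=> [] ; elim/forall_ord5=> // _; apply: iter3_braid.
- by elim/forall_ord5=> [] ; elim/forall_ord5=> // _; apply: iter4_braid.
- by elim/forall_ord5.
Qed.
End RelationsOnRatfun.

(** * Points where a rational function is undefined *)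

Section Definedness.
Variable C : numFieldType.

Lemma horner_mev (q : 'I_9 -> {poly C}) (p : 'I_9 -> C) (c : C) (a : ratpoly C) :
  (forall i, (q i).[c] = p i) -> (mev (@polyC C) q a).[c] = peval p a.
Proof.
move=> qp; elim/ratpoly_ind: a => [k|i|a b IHa IHb|a b IHa IHb].
- by rewrite mev_cst peval_cst hornerC.
- by rewrite mev_var peval_var.
- by rewrite !rmorphD hornerD IHa IHb.
- by rewrite !rmorphM hornerM IHa IHb.
Qed.

Definition line (p : 'I_9 -> C) (k i : 'I_9) : {poly C} :=
  (p i)%:P + (if i == k then 'X else 0).

Definition shift_coord (p : 'I_9 -> C) (k : 'I_9) (c : C) (i : 'I_9) : C :=
  p i + (if i == k then c else 0).

Lemma horner_line p k c i : (line p k i).[c] = shift_coord p k c i.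
Proof. by rewrite /line /shift_coord; case: ifP => _; rewrite !hornerE. Qed.

(* On a line through p where d vanishes identically but n does not, the denominator of
   every other representation of n / d vanishes identically as well.  Here the line
   varies the k-th coordinate, and n is nonzero at the parameter c. *)
Lemma undefined_at (f : ratfun C) (p : 'I_9 -> C) (n d : ratpoly C) k c :
  f * tofrac d = tofrac n -> mev (@polyC C) (line p k) d = 0 ->
  peval (shift_coord p k c) n != 0 -> ~ defined_at f p.
Proof.
move=> fdn qd pn [_ [a [b [b0 fab _]]]].
have qp i : (line p k i).[0] = p i.
  by rewrite horner_line /shift_coord if_same addr0.
have qn : mev (@polyC C) (line p k) n != 0.
  by apply: contra_neq pn => qn; rewrite -(horner_mev _ (horner_line p k c)) qn horner0.
have db : tofrac b != 0 :> ratfun C by apply: frac_denom_neq0 b0.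
have : a * d = b * n.
  apply/eqP; rewrite -tofrac_eq !tofracM -fdn fab; apply/eqP.
  by rewrite mulrA mulrCA divff // mulr1.
(* Restricted to the line, the product of [b] and [n] is zero in the integral domain [{poly C}].
   Since [n] is not zero there, [b] is, against [b0] at parameter 0, which is the point [p]. *)
move/(congr1 (mev (@polyC C) (line p k))); rewrite !rmorphM /= qd mulr0 => /esym/eqP.
rewrite mulf_eq0 (negbTE qn) orbF => /eqP qb.
by move: b0; rewrite -(horner_mev _ qp) qb horner0 eqxx.
Qed.
End Definedness.

(** * Rules for derivatives of functions of one variable *)

Section ScalarDerivatives.
Variable C : numFieldType.
Implicit Types (f g : C -> C) (t df dg : C).

Lemma is_derive_add f g t df dg : is_derive t 1 f df -> is_derive t 1 g dg ->
  is_derive t 1 (fun s => f s + g s) (df + dg).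
Proof. exact: is_deriveD. Qed.

Lemma is_derive_opp f t df : is_derive t 1 f df -> is_derive t 1 (fun s => - f s) (- df).
Proof. exact: is_deriveN. Qed.

Lemma is_derive_mul f g t df dg : is_derive t 1 f df -> is_derive t 1 g dg ->
  is_derive t 1 (fun s => f s * g s) (f t * dg + g t * df).
Proof. exact: is_deriveM. Qed.

Lemma is_derive_sqr f t df : is_derive t 1 f df ->
  is_derive t 1 (fun s => f s ^+ 2) (2 * f t * df).
Proof.
move=> fd; have fdd := is_derive_mul fd fd.
by rewrite mulrDl mul1r mulrDl in fdd *.
Qed.

Lemma is_derive_inv f t df : f t != 0 -> is_derive t 1 f df ->
  is_derive t 1 (fun s => (f s)^-1) (- (f t) ^- 2 * df).
Proof.
move=> ft0 [fd fE]; split; first exact: derivableV.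
by rewrite deriveV // fE.
Qed.

Lemma is_derive_const t (c : C) : is_derive t 1 (fun _ : C => c) 0.
Proof. exact: is_derive_cst. Qed.

Lemma is_derive_var t : is_derive t 1 (fun s : C => s) (1 : C).
Proof. exact: is_derive_id. Qed.

(** Chain rule through differentials: the differential of negation sends the direction 1 to -1, and
    linearity of the differential of [f] brings the sign out. *)
Lemma is_derive_reflect f t df :
  is_derive t 1 f df -> is_derive (- t) 1 (fun s => f (- s)) (- df).
Proof.
move=> [/derivable1_diffP df' fE].
have dN : differentiable (-%R : C -> C) (- t).
  by apply/derivable1_diffP; have [] := is_deriveNid (- t) (1 : C).
have df'' : differentiable f (- - t) by rewrite opprK.
have dfN : differentiable (f \o -%R) (- t) by apply: differentiable_comp.
split; first exact/derivable1_diffP.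
rewrite (deriveE _ dfN).
rewrite (diff_comp dN df'').
have [_ dNE] := is_deriveNid (- t) (1 : C).
have dNE' := etrans (esym (deriveE (1 : C) dN)) dNE.
transitivity ('d f (- - t) (-1)); first exact: (congr1 ('d f (- - t)) dNE').
by rewrite linearN -fE (deriveE _ df') opprK.
Qed.
End ScalarDerivatives.

(** * Time reversal of solutions *)

Section Reflection.
Variable C : numFieldType.

Lemma open_opp (D : set C) : open D -> open (-%R @` D).
Proof.
(* Negation is its own inverse, so the image is a preimage under a continuous map. *)
move=> oD; have -> : -%R @` D = -%R @^-1` D.
  apply/seteqP; split=> [_ [s Ds <-]|s Ds] /=; first by rewrite opprK.
  by exists (- s); rewrite ?opprK.
by apply: open_comp => // s _; apply: oppr_continuous.
Qed.

(** For the new time T = -t one has d/dT = -d/dt, so the system at time T becomes, in the old time,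
    the negated right-hand sides with t replaced by -t. This handles the reflection for both [s0]
    and [phi]. *)
Lemma reflected_solution (b0 b1 b2 b3 b4 : C) (D : set C) (x y z w : C -> C) :
  open D -> (forall t, D t -> t != 0) ->
  (forall t, D t ->
    [/\ is_derive t 1 x
          (- ((2 * x t ^+ 2 * y t - (- t) * x t ^+ 2 - 2 * b0 * x t + 1) / (- t)
           + 2 * x t ^+ 2 * w t / (- t))),
        is_derive t 1 y
          (- ((- 2 * x t * y t ^+ 2 + 2 * (- t) * x t * y t + 2 * b0 * y t + b1 * (- t))
              / (- t) - 2 * w t * (2 * x t * y t + b1) / (- t))),
        is_derive t 1 z
          (- ((2 * z t ^+ 2 * w t - (- t) * z t ^+ 2 - (1 - b3 - b4) * z t + 1) / (- t)
           + 2 * x t * (x t * y t + b1) / (- t)))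
      & is_derive t 1 w
          (- ((- 2 * z t * w t ^+ 2 + 2 * (- t) * z t * w t + (1 - b3 - b4) * w t
            + b3 * (- t)) / (- t)))]) ->
  is_solution b0 b1 b2 b3 b4 (-%R @` D) (fun s => x (- s)) (fun s => y (- s))
    (fun s => z (- s)) (fun s => w (- s)).
Proof.
move=> oD D0 dD; split=> [|_ [t Dt <-]|_ [t Dt <-]]; first exact: open_opp.
  by rewrite oppr_eq0 D0.
by have [] := dD t Dt; split; rewrite ?opprK;
  (apply: is_derive_eq; [exact: is_derive_reflect|rewrite opprK]).
Qed.
End Reflection.

Ltac has_value_tac := apply: has_value_eq; [frac_value_tac | rewrite /=].

(** Follows the syntax of the function and thereby instantiates its derivative;
    [notypeclasses refine] leaves the premises to this tactic instead of instance search. *)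
Ltac derivative_tac := repeat lazymatch goal with
  | H : is_derive ?t 1 ?f _ |- is_derive ?t 1 ?f _ => exact: H
  | |- is_true (_ ^+ _ != 0) => apply: expf_neq0
  | |- is_true (_ != 0) => assumption
  | |- is_derive _ _ (fun s => s) _ => apply: is_derive_var
  | |- is_derive _ _ (fun _ => ?c) _ => apply: is_derive_const
  | |- is_derive _ _ (fun s => @?f s + @?g s) _ => notypeclasses refine (@is_derive_add _ f g _ _ _ _ _)
  | |- is_derive _ _ (fun s => - @?f s) _ => notypeclasses refine (@is_derive_opp _ f _ _ _)
  | |- is_derive _ _ (fun s => @?f s * @?g s) _ => notypeclasses refine (@is_derive_mul _ f g _ _ _ _ _)
  | |- is_derive _ _ (fun s => @?f s ^+ 2) _ => notypeclasses refine (@is_derive_sqr _ f _ _ _)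
  | |- is_derive _ _ (fun s => (@?f s)^-1) _ => notypeclasses refine (@is_derive_inv _ f _ _ _ _)
  end.

Ltac solve_derivatives :=
  split; (notypeclasses refine (is_derive_eq _ _);
    [by derivative_tac | rewrite /=; field; repeat (apply/andP; split); assumption]).

Ltac morph_push :=
  rewrite !(rmorph1, rmorph_nat, rmorphXn, rmorphB, rmorphD, rmorphN, rmorphM) /=.

(** * The Bäcklund property of each generator *)

Section BacklundTransformations.
Variable C : numFieldType.
Local Notation X k := (pvar C (@Ordinal 9 k isT)).

(** Points have nine coordinates and [ra4] is an expression in four of them, so the numerical [a4]
    has to be rewritten in the same way. *)
Lemma eliminate_a4 (a0 a1 a2 a3 a4 : C) : 2 * a0 + 2 * a1 + 2 * a2 + a3 + a4 = 1 ->
  a4 = 1 - 2 * a0 - 2 * a1 - 2 * a2 - a3.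
Proof.
move=> rel; have -> : a4 = (2 * a0 + 2 * a1 + 2 * a2 + a3 + a4) - 2 * a0 - 2 * a1 - 2 * a2 - a3.
  by ring.
by rewrite rel.
Qed.

(** Clears the denominator of the image of y, in the shape that [undefined_at] asks for. *)
Lemma s0_y_numerator (K : fieldType) (x y a0 : K) : x != 0 ->
  (- y + 2 * a0 / x - 1 / x ^+ 2) * x ^+ 2 = - y * x ^+ 2 + 2 * a0 * x - 1.
Proof. by move=> x0; field. Qed.

Lemma Backlund_s0 (sigma : ratfun C -> ratfun C) :
  map sigma (gens C) = s0_images C -> Backlund sigma.
Proof.
move=> [ex ey ez ew et e0 e1 e2 e3 e4] a0 a1 a2 a3 a4 D x y z w rel [oD D0 dD] p def.
have a4E := eliminate_a4 rel.
have den0 t : D t -> x t != 0.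
  move=> Dt; apply/eqP => den; have := def t Dt _ (@mem_nth _ 0 (gens C) 1 isT).
  rewrite /= ey.
  (* Where x = 0 the numerator is already -1, so the shift 0 suffices; varying y keeps x = 0 along
     the line. *)
  apply: (@undefined_at C _ _ (- X 1 * X 0 ^+ 2 + 2 * X 5 * X 0 - 1)
    (X 0 ^+ 2) (@Ordinal 9 1 isT) 0).
  - morph_push; rewrite !tofrac_var.
    exact: (s0_y_numerator _ _ (rx_neq0 _)).
  - by rewrite rmorphXn /= mev_var /line /p /= den addr0 expr0n.
  - morph_push; rewrite !peval_var /shift_coord /p /= !addr0 den.
    by rewrite expr0n !mulr0 addr0 sub0r oppr_eq0 oner_neq0.
(* The new time is -t, so at new time [s] the old solution is read at [- s]. *)
exists (- a0), (a1 + 2 * a0), a2, a3, a4, -%R,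
  (fun s => - x (- s)),
  (fun s => - y (- s) + 2 * a0 / x (- s) - 1 / x (- s) ^+ 2),
  (fun s => - z (- s)),
  (fun s => - w (- s)).
split=> [t Dt|].
  rewrite ex ey ez ew et e0 e1 e2 e3 e4 /ra4; split; [|split|split];
    has_value_tac; rewrite ?opprK ?a4E //; do ?apply: expf_neq0; exact: den0.
apply (@reflected_solution C _ _ _ _ _ D
  (fun t => - x t)
  (fun t => - y t + 2 * a0 / x t - 1 / x t ^+ 2)
  (fun t => - z t)
  (fun t => - w t)) => // t Dt.
have [dx dy dz dw] := dD t Dt; have t0 := D0 t Dt.
have den := den0 t Dt.
have nt0 : - t != 0 by rewrite oppr_eq0.
rewrite a4E in dx dy dz dw *.
solve_derivatives.
Qed.

Lemma Backlund_s1 (sigma : ratfun C -> ratfun C) :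
  map sigma (gens C) = s1_images C -> Backlund sigma.
Proof.
move=> [ex ey ez ew et e0 e1 e2 e3 e4] a0 a1 a2 a3 a4 D x y z w rel [oD D0 dD] p def.
have a4E := eliminate_a4 rel.
have den0 t : D t -> y t != 0.
  move=> Dt; apply/eqP => den; have := def t Dt _ (@mem_nth _ 0 (gens C) 0 isT).
  rewrite /= ex.
  (* The numerator may vanish at the point itself when [a1 = 0], so the line varies the parameter
     alpha_1; the shift [1 - a1] makes the numerator 1 where y = 0. *)
  apply: (@undefined_at C _ _ (X 0 * X 1 + X 6)
    (X 1) (@Ordinal 9 6 isT) (1 - a1)).
  - by rewrite rmorphD rmorphM /= !tofrac_var mulrDl mulfVK ?ry_neq0.
  - by rewrite mev_var /line /p /= den addr0.
  - morph_push; rewrite !peval_var /shift_coord /p /= !addr0 den mulr0 add0r subrKC.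
    exact: oner_neq0.
exists (a0 + a1), (- a1), (a2 + a1), a3, a4, id,
  (fun t => x t + a1 / y t),
  y,
  z,
  w.
split=> [t Dt|].
  rewrite ex ey ez ew et e0 e1 e2 e3 e4 /ra4; split; [|split|split];
    has_value_tac; rewrite ?opprK ?a4E //; do ?apply: expf_neq0; exact: den0.
rewrite image_id; split=> // t Dt.
have [dx dy dz dw] := dD t Dt; have t0 := D0 t Dt.
have den := den0 t Dt.
rewrite a4E in dx dy dz dw *.
solve_derivatives.
Qed.

Lemma Backlund_s2 (sigma : ratfun C -> ratfun C) :
  map sigma (gens C) = s2_images C -> Backlund sigma.
Proof.
move=> [ex ey ez ew et e0 e1 e2 e3 e4] a0 a1 a2 a3 a4 D x y z w rel [oD D0 dD] p def.
have a4E := eliminate_a4 rel.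
have den0 t : D t -> x t - z t != 0.
  move=> Dt; apply/eqP => den; have := def t Dt _ (@mem_nth _ 0 (gens C) 1 isT).
  rewrite /= ey.
  apply: (@undefined_at C _ _ (X 1 * (X 0 - X 2) - X 7)
    (* Varying alpha_2 up to 1 makes the numerator -1 where x = z, even if [a2 = 0]. *)
    (X 0 - X 2) (@Ordinal 9 7 isT) (1 - a2)).
  - by rewrite !(rmorphB, rmorphM) /= !tofrac_var mulrBl mulfVK ?rx_neq_rz.
  - by rewrite rmorphB /= !mev_var /line /p /= !addr0 -polyCB den.
  - morph_push; rewrite !peval_var /shift_coord /p /= !addr0 den mulr0 sub0r subrKC oppr_eq0.
    exact: oner_neq0.
exists a0, (a1 + a2), (- a2), (a3 + a2), (a4 + a2), id,
  x,
  (fun t => y t - a2 / (x t - z t)),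
  z,
  (fun t => w t + a2 / (x t - z t)).
split=> [t Dt|].
  rewrite ex ey ez ew et e0 e1 e2 e3 e4 /ra4; split; [|split|split];
    has_value_tac; rewrite ?opprK ?a4E //; do ?apply: expf_neq0; exact: den0.
rewrite image_id; split=> // t Dt.
have [dx dy dz dw] := dD t Dt; have t0 := D0 t Dt.
have den := den0 t Dt.
rewrite a4E in dx dy dz dw *.
solve_derivatives.
Qed.

Lemma Backlund_s3 (sigma : ratfun C -> ratfun C) :
  map sigma (gens C) = s3_images C -> Backlund sigma.
Proof.
move=> [ex ey ez ew et e0 e1 e2 e3 e4] a0 a1 a2 a3 a4 D x y z w rel [oD D0 dD] p def.
have a4E := eliminate_a4 rel.
have den0 t : D t -> w t != 0.
  move=> Dt; apply/eqP => den; have := def t Dt _ (@mem_nth _ 0 (gens C) 2 isT).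
  rewrite /= ez.
  apply: (@undefined_at C _ _ (X 2 * X 3 + X 8)
    (* Varying alpha_3 up to 1 makes the numerator 1 where w = 0, even if [a3 = 0]. *)
    (X 3) (@Ordinal 9 8 isT) (1 - a3)).
  - by rewrite rmorphD rmorphM /= !tofrac_var mulrDl mulfVK ?rw_neq0.
  - by rewrite mev_var /line /p /= den addr0.
  - morph_push; rewrite !peval_var /shift_coord /p /= !addr0 den mulr0 add0r subrKC.
    exact: oner_neq0.
exists a0, a1, (a2 + a3), (- a3), a4, id,
  x,
  y,
  (fun t => z t + a3 / w t),
  w.
split=> [t Dt|].
  rewrite ex ey ez ew et e0 e1 e2 e3 e4 /ra4; split; [|split|split];
    has_value_tac; rewrite ?opprK ?a4E //; do ?apply: expf_neq0; exact: den0.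
rewrite image_id; split=> // t Dt.
have [dx dy dz dw] := dD t Dt; have t0 := D0 t Dt.
have den := den0 t Dt.
rewrite a4E in dx dy dz dw *.
solve_derivatives.
Qed.

Lemma Backlund_s4 (sigma : ratfun C -> ratfun C) :
  map sigma (gens C) = s4_images C -> Backlund sigma.
Proof.
move=> [ex ey ez ew et e0 e1 e2 e3 e4] a0 a1 a2 a3 a4 D x y z w rel [oD D0 dD] p def.
have a4E := eliminate_a4 rel.
have den0 t : D t -> w t - t != 0.
  move=> Dt; apply/eqP => den; have := def t Dt _ (@mem_nth _ 0 (gens C) 2 isT).
  rewrite /= ez.
  (* Since alpha_4 is not a coordinate, alpha_3 is varied in its place: raising it by [a4 - 1]
     lowers alpha_4 to 1, hence the numerator is 1 where w = t. *)
  apply: (@undefined_at C _ _ (X 2 * (X 3 - X 4) + (1 - 2 * X 5 - 2 * X 6 - 2 * X 7 - X 8))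
    (X 3 - X 4) (@Ordinal 9 8 isT) (a4 - 1)).
  - morph_push; rewrite !tofrac_var.
    by rewrite mulrDl mulfVK ?rw_neq_rt.
  - by rewrite rmorphB /= !mev_var /line /p /= !addr0 -polyCB den.
  - morph_push; rewrite !peval_var /shift_coord /p /= !addr0 den mulr0 add0r opprD addrA -a4E.
    by rewrite opprB addrC subrK oner_neq0.
exists a0, a1, (a2 + a4), a3, (- a4), id,
  x,
  y,
  (fun t => z t + a4 / (w t - t)),
  w.
split=> [t Dt|].
  rewrite ex ey ez ew et e0 e1 e2 e3 e4 /ra4; split; [|split|split];
    has_value_tac; rewrite ?opprK ?a4E //; do ?apply: expf_neq0; exact: den0.
rewrite image_id; split=> // t Dt.
have [dx dy dz dw] := dD t Dt; have t0 := D0 t Dt.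
have den := den0 t Dt.
rewrite a4E in dx dy dz dw *.
solve_derivatives.
Qed.

(** The images are polynomials, so there are no poles to exclude; only the time reversal remains. *)
Lemma Backlund_phi (sigma : ratfun C -> ratfun C) :
  map sigma (gens C) = phi_images C -> Backlund sigma.
Proof.
move=> [ex ey ez ew et e0 e1 e2 e3 e4] a0 a1 a2 a3 a4 D x y z w rel [oD D0 dD] p def.
have a4E := eliminate_a4 rel.
exists a0, a1, a2, a4, a3, -%R,
  (fun s => x (- s)),
  (fun s => y (- s)),
  (fun s => z (- s)),
  (* The image w - t, read at the old time t = -s. *)
  (fun s => w (- s) - (- s)).
split=> [t Dt|].
  rewrite ex ey ez ew et e0 e1 e2 e3 e4 /ra4; split; [|split|split];
    has_value_tac; rewrite ?opprK ?a4E //.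
apply (@reflected_solution C _ _ _ _ _ D
  (fun t => x t)
  (fun t => y t)
  (fun t => z t)
  (fun t => w t - t)) => // t Dt.
have [dx dy dz dw] := dD t Dt; have t0 := D0 t Dt.
have nt0 : - t != 0 by rewrite oppr_eq0.
rewrite a4E in dx dy dz dw *.
solve_derivatives.
Qed.
End BacklundTransformations.

Theorem theorem3p1 (R : realType) :
  [/\ forall i : 'I_5, exists s : {rmorphism ratfun R[i] -> ratfun R[i]},
        automorphism_with_images (s_images R[i] i) s,
      exists phi : {rmorphism ratfun R[i] -> ratfun R[i]},
        automorphism_with_images (phi_images R[i]) phi
    & forall (s : 'I_5 -> {rmorphism ratfun R[i] -> ratfun R[i]})
             (phi : {rmorphism ratfun R[i] -> ratfun R[i]}),
        (forall i, automorphism_with_images (s_images R[i] i) (s i)) ->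
        automorphism_with_images (phi_images R[i]) phi ->
        [/\ forall i, Backlund (s i),
            Backlund phi
          & extended_B4_relations s phi]].
Proof.
split=> [i||s phi es ephi]; [exact: s_automorphism | exact: phi_automorphism |].
split; last exact: images_relations.
- have e i : map (s i) (gens R[i]) = s_images R[i] i by have [] := es i.
  elim/forall_ord5.
  + exact: (Backlund_s0 (e (@Ordinal 5 0 isT))).
  + exact: (Backlund_s1 (e (@Ordinal 5 1 isT))).
  + exact: (Backlund_s2 (e (@Ordinal 5 2 isT))).
  + exact: (Backlund_s3 (e (@Ordinal 5 3 isT))).
  + exact: (Backlund_s4 (e (@Ordinal 5 4 isT))).
- by apply: Backlund_phi; have [] := ephi.
Qed.
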